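(* Let $\Sigma$ be any set of sequents in the language of $\mathbf{MPDBL}$. If an s-hypersequent $\alpha_1\vdash\beta_1\mid\dots\mid\alpha_n\vdash\beta_n$ is valid in the class $V_\Sigma$ of all pure double Boolean algebras with operators in which every sequent of $\Sigma$ is valid, then it is provable in $\mathbf{MPDBL}\Sigma$.
   Context: Pure double Boolean algebras. A double Boolean algebra is an algebra $\mathbf{D}=(D,\sqcup,\sqcap,\neg,\lrcorner,\top,\bot)$ such that, writing $x\vee y:=\neg(\neg x\sqcap\neg y)$ and $x\wedge y:=\lrcorner(\lrcorner x\sqcup\lrcorner y)$, for all $x,y,z$: $(x\sqcap x)\sqcap y=x\sqcap y$; $(x\sqcup x)\sqcup y=x\sqcup y$; $\sqcap,\sqcup$ commutative and associative; $\neg(x\sqcap x)=\neg x$; $\lrcorner(x\sqcup x)=\lrcorner x$; $x\sqcap(x\sqcup y)=x\sqcap x$; $x\sqcup(x\sqcap y)=x\sqcup x$; $x\sqcap(y\vee z)=(x\sqcap y)\vee(x\sqcap z)$; $x\sqcup(y\wedge z)=(x\sqcup y)\wedge(x\sqcup z)$; $x\sqcap(x\vee y)=x\sqcap x$; $x\sqcup(x\wedge y)=x\sqcup x$; $\neg\neg(x\sqcap y)=x\sqcap y$; $\lrcorner\lrcorner(x\sqcup y)=x\sqcup y$; $x\sqcap\neg x=\bot$; $x\sqcup\lrcorner x=\top$; $\neg\bot=\top\sqcap\top$; $\lrcorner\top=\bot\sqcup\bot$; $\neg\top=\bot$; $\lrcorner\bot=\top$; $(x\sqcap x)\sqcup(x\sqcap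 x)=(x\sqcup x)\sqcap(x\sqcup x)$. It is pure (pdBa) if each $x$ satisfies $x\sqcap x=x$ or $x\sqcup x=x$. $D_\sqcap=\{x:x\sqcap x=x\}$, $D_\sqcup=\{x:x\sqcup x=x\}$; $x\sqsubseteq y$ iff $x\sqcap y=x\sqcap x$ and $x\sqcup y=y\sqcup y$. A pdBa with operators (pdBao) is a pdBa with two maps $\mathbf{I},\mathbf{C}:D\to D$, monotone w.r.t. $\sqsubseteq$, such that $\mathbf{I}(x\sqcap y)=\mathbf{I}(x)\sqcap\mathbf{I}(y)$, $\mathbf{C}(x\sqcup y)=\mathbf{C}(x)\sqcup\mathbf{C}(y)$, $\mathbf{I}(\neg\bot)=\neg\bot$, $\mathbf{C}(\lrcorner\top)=\lrcorner\top$, $\mathbf{I}(x\sqcap x)=\mathbf{I}(x)$, $\mathbf{C}(x\sqcup x)=\mathbf{C}(x)$. The logic PDBL. Variables: object variables $\mathbf{OV}$ ($p,\dots$) and property variables $\mathbf{PV}$ ($P,\dots$), disjoint countably infinite sets; constants $\top,\bot$; connectives $\sqcap,\sqcup$ (binary), $\neg,\lrcorner$ (unary). $\alpha\vee\beta:=\neg(\neg\alpha\sqcap\neg\beta)$, $\alpha\wedge\beta:=\lrcorner(\lrcorner\alpha\sqcup\lrcorner\beta)$. Sequents $\alpha\vdash\beta$ ($\alpha\dashv\vdash\beta$ means both directions); s-hypersequents are finite sequences $\alpha_1\vdash\beta_1\mid\dots\mid\alpha_n\vdash\beta_n$; $B,C,\dots,X$ range over possibly empty s-hypersequents. Axioms: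 $\alpha\vdash\alpha$; $\alpha\sqcap\beta\vdash\alpha$; $\alpha\sqcap\beta\vdash\beta$; $\alpha\vdash\alpha\sqcup\beta$; $\beta\vdash\alpha\sqcup\beta$; $\alpha\sqcap\beta\vdash(\alpha\sqcap\beta)\sqcap(\alpha\sqcap\beta)$; $(\alpha\sqcup\beta)\sqcup(\alpha\sqcup\beta)\vdash\alpha\sqcup\beta$; $\neg(\alpha\sqcap\alpha)\vdash\neg\alpha$; $\lrcorner\alpha\vdash\lrcorner(\alpha\sqcup\alpha)$; $\alpha\sqcap\neg\alpha\vdash\bot$; $\top\vdash\alpha\sqcup\lrcorner\alpha$; $\neg\neg(\alpha\sqcap\beta)\dashv\vdash\alpha\sqcap\beta$; $\lrcorner\lrcorner(\alpha\sqcup\beta)\dashv\vdash\alpha\sqcup\beta$; $\alpha\sqcap\alpha\vdash\alpha\sqcap(\alpha\sqcup\beta)$; $\alpha\sqcup(\alpha\sqcap\beta)\vdash\alpha\sqcup\alpha$; $\alpha\sqcap\alpha\vdash\alpha\sqcap(\alpha\vee\beta)$; $\alpha\sqcup(\alpha\wedge\beta)\vdash\alpha\sqcup\alpha$; $\alpha\sqcap(\beta\vee\gamma)\dashv\vdash(\alpha\sqcap\beta)\vee(\alpha\sqcap\gamma)$; $\alpha\sqcup(\beta\wedge\gamma)\dashv\vdash(\alpha\sqcup\beta)\wedge(\alpha\sqcup\gamma)$; $\bot\vdash\alpha$; $\alpha\vdash\top$; $\neg\top\vdash\bot$; $\top\vdash\lrcorner\bot$; $\neg\bot\dashv\vdash\top\sqcap\top$;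 $\lrcorner\top\dashv\vdash\bot\sqcup\bot$; $(\alpha\sqcup\alpha)\sqcap(\alpha\sqcup\alpha)\dashv\vdash(\alpha\sqcap\alpha)\sqcup(\alpha\sqcap\alpha)$; $p\sqcap p\dashv\vdash p$ ($p\in\mathbf{OV}$); $P\sqcup P\dashv\vdash P$ ($P\in\mathbf{PV}$); (Sp) $\alpha\vdash\alpha\sqcap\alpha\mid\alpha\sqcup\alpha\vdash\alpha$. Rules: from $B\mid\alpha\vdash\beta\mid C$ infer $B\mid\alpha\sqcap\gamma\vdash\beta\sqcap\gamma\mid C$, $B\mid\gamma\sqcap\alpha\vdash\gamma\sqcap\beta\mid C$, $B\mid\alpha\sqcup\gamma\vdash\beta\sqcup\gamma\mid C$, $B\mid\gamma\sqcup\alpha\vdash\gamma\sqcup\beta\mid C$, $B\mid\neg\beta\vdash\neg\alpha\mid C$, $B\mid\lrcorner\beta\vdash\lrcorner\alpha\mid C$; from $B\mid\alpha\vdash\beta\mid C$ and $D\mid\beta\vdash\gamma\mid E$ infer $B\mid D\mid\alpha\vdash\gamma\mid C\mid E$; from $B\mid\alpha\sqcap\beta\vdash\alpha\sqcap\alpha\mid C$, $D\mid\alpha\sqcap\alpha\vdash\alpha\sqcap\beta\mid E$, $F\mid\alpha\sqcup\beta\vdash\beta\sqcup\beta\mid G$, $H\mid\beta\sqcup\beta\vdash\alpha\sqcup\beta\mid X$ infer $B\mid D\mid F\mid H\mid\alpha\vdash\beta\mid C\mid E\mid G\mid X$; external: from $B\mid D\mid D\mid C$ infer $B\mid D\mid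 C$; from $B\mid D\mid E\mid C$ infer $B\mid E\mid D\mid C$; from $B$ infer $B\mid C$. MPDBL and MPDBLΣ. $\mathbf{MPDBL}$ adds unary connectives $\square,\blacksquare$ to the language (all PDBL axiom schemes and rules now range over the enlarged set of formulae), with additional axioms $\square\alpha\sqcap\square\beta\dashv\vdash\square(\alpha\sqcap\beta)$; $\blacksquare\alpha\sqcup\blacksquare\beta\dashv\vdash\blacksquare(\alpha\sqcup\beta)$; $\square(\neg\bot)\dashv\vdash\neg\bot$; $\blacksquare(\lrcorner\top)\dashv\vdash\lrcorner\top$; $\square(\alpha\sqcap\alpha)\dashv\vdash\square\alpha$; $\blacksquare(\alpha\sqcup\alpha)\dashv\vdash\blacksquare\alpha$, and rules: from $B\mid\alpha\vdash\beta\mid C$ infer $B\mid\square\alpha\vdash\square\beta\mid C$ and $B\mid\blacksquare\alpha\vdash\blacksquare\beta\mid C$. For a set $\Sigma$ of sequents, $\mathbf{MPDBL}\Sigma$ is $\mathbf{MPDBL}$ with all sequents of $\Sigma$ added as axioms. Provability is via finite derivations. Semantics. A valuation on a pdBao is a map $v$ with $v(p)\in D_\sqcap$, $v(P)\in D_\sqcup$, $v(\top)=\top$, $v(\bot)=\bot$, extended homomorphically, with $v(\square\alpha)=\mathbf{I}(v(\alpha))$, $v(\blacksquare\alpha)=\mathbf{C}(v(\alpha))$. $v$ satisfies $\alpha\vdash\beta$ iff $v(\alpha)\sqsubseteq v(\beta)$, and an s-hypersequent iff it satisfies some component; an s-hypersequent is true in an algebra if every valuation satisfies it and valid in a class if true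 in each member.
   Formalization: The sequents of Σ are added as axiom schemes: each instance sending object variables to object variables or c⊓c, and property variables to property variables or c⊔c, is an axiom; read literally the claim fails (Σ={p⊢q}: q⊢p is valid in V_Σ but unprovable). *)

(* Defs.v *)
From Stdlib Require Export List.
Export ListNotations.

Declare Scope dba_scope.
Delimit Scope dba_scope with dba.
Declare Scope form_scope.
Delimit Scope form_scope with form.

Record dba_sig : Type := DbaSig {
  carrier :> Type;
  djoin : carrier -> carrier -> carrier;
  dmeet : carrier -> carrier -> carrier;
  dneg  : carrier -> carrier;
  dopp  : carrier -> carrier;
  dtop  : carrier;
  dbot  : carrier }.

Arguments djoin {_} _ _.
Arguments dmeet {_} _ _.
Arguments dneg {_} _.
Arguments dopp {_} _.
Arguments dtop {_}.
Arguments dbot {_}.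

Notation "x ⊓ y" := (dmeet x y) (at level 40, left associativity) : dba_scope.
Notation "x ⊔ y" := (djoin x y) (at level 50, left associativity) : dba_scope.
Notation "¬ x" := (dneg x) (at level 35, right associativity) : dba_scope.
Notation "⌟ x" := (dopp x) (at level 35, right associativity) : dba_scope.
Notation "⊤" := dtop : dba_scope.
Notation "⊥" := dbot : dba_scope.
(* [⩔] and [⩓] are the derived operations written \vee and \wedge in the
   literature; [/\] and [\/] stay reserved for propositions. *)
Notation "x ⩔ y" := (dneg (dmeet (dneg x) (dneg y)))
  (at level 50, left associativity) : dba_scope.
Notation "x ⩓ y" := (dopp (djoin (dopp x) (dopp y)))
  (at level 40, left associativity) : dba_scope.

Record is_dba (D : dba_sig) : Prop := IsDba {
  dba_meet_idl : forall x y : D, ((x ⊓ x) ⊓ y = x ⊓ y)%dba;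
  dba_join_idl : forall x y : D, ((x ⊔ x) ⊔ y = x ⊔ y)%dba;
  dba_meetC : forall x y : D, (x ⊓ y = y ⊓ x)%dba;
  dba_joinC : forall x y : D, (x ⊔ y = y ⊔ x)%dba;
  dba_meetA : forall x y z : D, (x ⊓ (y ⊓ z) = (x ⊓ y) ⊓ z)%dba;
  dba_joinA : forall x y z : D, (x ⊔ (y ⊔ z) = (x ⊔ y) ⊔ z)%dba;
  dba_neg_meet : forall x : D, (¬ (x ⊓ x) = ¬ x)%dba;
  dba_opp_join : forall x : D, (⌟ (x ⊔ x) = ⌟ x)%dba;
  dba_meet_join : forall x y : D, (x ⊓ (x ⊔ y) = x ⊓ x)%dba;
  dba_join_meet : forall x y : D, (x ⊔ (x ⊓ y) = x ⊔ x)%dba;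
  dba_meet_vee : forall x y z : D, (x ⊓ (y ⩔ z) = (x ⊓ y) ⩔ (x ⊓ z))%dba;
  dba_join_wedge : forall x y z : D, (x ⊔ (y ⩓ z) = (x ⊔ y) ⩓ (x ⊔ z))%dba;
  dba_meet_veeK : forall x y : D, (x ⊓ (x ⩔ y) = x ⊓ x)%dba;
  dba_join_wedgeK : forall x y : D, (x ⊔ (x ⩓ y) = x ⊔ x)%dba;
  dba_negneg : forall x y : D, (¬ ¬ (x ⊓ y) = x ⊓ y)%dba;
  dba_oppopp : forall x y : D, (⌟ ⌟ (x ⊔ y) = x ⊔ y)%dba;
  dba_meet_neg : forall x : D, (x ⊓ ¬ x = ⊥)%dba;
  dba_join_opp : forall x : D, (x ⊔ ⌟ x = ⊤)%dba;
  dba_neg_bot : (¬ ⊥ = ⊤ ⊓ ⊤ :> D)%dba;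
  dba_opp_top : (⌟ ⊤ = ⊥ ⊔ ⊥ :> D)%dba;
  dba_neg_top : (¬ ⊤ = ⊥ :> D)%dba;
  dba_opp_bot : (⌟ ⊥ = ⊤ :> D)%dba;
  dba_meet_join_id : forall x : D,
    ((x ⊓ x) ⊔ (x ⊓ x) = (x ⊔ x) ⊓ (x ⊔ x))%dba }.

Definition D_meet (D : dba_sig) (x : D) : Prop := (x ⊓ x = x)%dba.
Definition D_join (D : dba_sig) (x : D) : Prop := (x ⊔ x = x)%dba.

Definition is_pure (D : dba_sig) : Prop :=
  forall x : D, D_meet D x \/ D_join D x.

Definition dle (D : dba_sig) (x y : D) : Prop :=
  (x ⊓ y = x ⊓ x)%dba /\ (x ⊔ y = y ⊔ y)%dba.

Record pdbao : Type := Pdbao {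
  pdbao_sig :> dba_sig;
  opI : pdbao_sig -> pdbao_sig;
  opC : pdbao_sig -> pdbao_sig;
  pdbao_dba : is_dba pdbao_sig;
  pdbao_pure : is_pure pdbao_sig;
  opI_mono : forall x y, dle pdbao_sig x y -> dle pdbao_sig (opI x) (opI y);
  opC_mono : forall x y, dle pdbao_sig x y -> dle pdbao_sig (opC x) (opC y);
  opI_meet : forall x y, (opI (x ⊓ y) = opI x ⊓ opI y)%dba;
  opC_join : forall x y, (opC (x ⊔ y) = opC x ⊔ opC y)%dba;
  opI_neg_bot : (opI (¬ ⊥) = ¬ ⊥)%dba;
  opC_opp_top : (opC (⌟ ⊤) = ⌟ ⊤)%dba;
  opI_idem : forall x, (opI (x ⊓ x) = opI x)%dba;
  opC_idem : forall x, (opC (x ⊔ x) = opC x)%dba }.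

Arguments opI {_} _.
Arguments opC {_} _.

Inductive form : Type :=
| OVar (n : nat)
| PVar (n : nat)
| Top
| Bot
| Meet (a b : form)
| Join (a b : form)
| Neg (a : form)
| Opp (a : form)
| Box (a : form)
| BBox (a : form).

Notation "a ⊓ b" := (Meet a b) (at level 40, left associativity) : form_scope.
Notation "a ⊔ b" := (Join a b) (at level 50, left associativity) : form_scope.
Notation "¬ a" := (Neg a) (at level 35, right associativity) : form_scope.
Notation "⌟ a" := (Opp a) (at level 35, right associativity) : form_scope.
Notation "□ a" := (Box a) (at level 35, right associativity) : form_scope.
Notation "■ a" := (BBox a) (at level 35, right associativity) : form_scope.
Notation "⊤" := Top : form_scope.
Notation "⊥" := Bot : form_scope.
Notation "a ⩔ b" := (Neg (Meet (Neg a) (Neg b)))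
  (at level 50, left associativity) : form_scope.
Notation "a ⩓ b" := (Opp (Join (Opp a) (Opp b)))
  (at level 40, left associativity) : form_scope.

Record sequent : Type := Seq { lhs : form; rhs : form }.
Definition hypersequent : Type := list sequent.

Notation "a ⊢ b" := (Seq a%form b%form) (at level 55, no associativity).

Inductive ax_le : form -> form -> Prop :=
| ax_refl a : ax_le a a
| ax_meetl a b : ax_le (a ⊓ b)%form a
| ax_meetr a b : ax_le (a ⊓ b)%form b
| ax_joinl a b : ax_le a (a ⊔ b)%form
| ax_joinr a b : ax_le b (a ⊔ b)%form
| ax_meet_dup a b : ax_le (a ⊓ b)%form ((a ⊓ b) ⊓ (a ⊓ b))%form
| ax_join_dup a b : ax_le ((a ⊔ b) ⊔ (a ⊔ b))%form (a ⊔ b)%form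
| ax_neg_meet a : ax_le (¬ (a ⊓ a))%form (¬ a)%form
| ax_opp_join a : ax_le (⌟ a)%form (⌟ (a ⊔ a))%form
| ax_meet_neg a : ax_le (a ⊓ ¬ a)%form ⊥%form
| ax_join_opp a : ax_le ⊤%form (a ⊔ ⌟ a)%form
| ax_meet_join a b : ax_le (a ⊓ a)%form (a ⊓ (a ⊔ b))%form
| ax_join_meet a b : ax_le (a ⊔ (a ⊓ b))%form (a ⊔ a)%form
| ax_meet_veeK a b : ax_le (a ⊓ a)%form (a ⊓ (a ⩔ b))%form
| ax_join_wedgeK a b : ax_le (a ⊔ (a ⩓ b))%form (a ⊔ a)%form
| ax_bot a : ax_le ⊥%form a
| ax_top a : ax_le a ⊤%form
| ax_neg_top : ax_le (¬ ⊤)%form ⊥%form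
| ax_opp_bot : ax_le ⊤%form (⌟ ⊥)%form.

(* Axioms [a ⊣⊢ b], standing for both [a ⊢ b] and [b ⊢ a]. *)
Inductive ax_eq : form -> form -> Prop :=
| ax_negneg a b : ax_eq (¬ ¬ (a ⊓ b))%form (a ⊓ b)%form
| ax_oppopp a b : ax_eq (⌟ ⌟ (a ⊔ b))%form (a ⊔ b)%form
| ax_meet_vee a b c : ax_eq (a ⊓ (b ⩔ c))%form ((a ⊓ b) ⩔ (a ⊓ c))%form
| ax_join_wedge a b c : ax_eq (a ⊔ (b ⩓ c))%form ((a ⊔ b) ⩓ (a ⊔ c))%form
| ax_neg_bot : ax_eq (¬ ⊥)%form (⊤ ⊓ ⊤)%form
| ax_opp_top : ax_eq (⌟ ⊤)%form (⊥ ⊔ ⊥)%form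
| ax_meet_join_id a :
    ax_eq ((a ⊔ a) ⊓ (a ⊔ a))%form ((a ⊓ a) ⊔ (a ⊓ a))%form
| ax_ovar p : ax_eq (OVar p ⊓ OVar p)%form (OVar p)
| ax_pvar P : ax_eq (PVar P ⊔ PVar P)%form (PVar P)
| ax_box_meet a b : ax_eq (□ a ⊓ □ b)%form (□ (a ⊓ b))%form
| ax_bbox_join a b : ax_eq (■ a ⊔ ■ b)%form (■ (a ⊔ b))%form
| ax_box_neg_bot : ax_eq (□ (¬ ⊥))%form (¬ ⊥)%form
| ax_bbox_opp_top : ax_eq (■ (⌟ ⊤))%form (⌟ ⊤)%form
| ax_box_idem a : ax_eq (□ (a ⊓ a))%form (□ a)%form
| ax_bbox_idem a : ax_eq (■ (a ⊔ a))%form (■ a)%form.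

(* Derivability in MPDBL from the extra axioms [Ax], each taken as it stands
   (no substitution rule).  [B | S | C] is encoded as [B ++ S :: C]. *)
Inductive derivable (Ax : sequent -> Prop) : hypersequent -> Prop :=
| d_ax s : Ax s -> derivable Ax [s]
| d_le a b : ax_le a b -> derivable Ax [a ⊢ b]
| d_eq a b : ax_eq a b -> derivable Ax [a ⊢ b]
| d_eq_sym a b : ax_eq a b -> derivable Ax [b ⊢ a]
| d_sp a : derivable Ax [a ⊢ a ⊓ a; a ⊔ a ⊢ a]
| d_meetl B C a b c :
    derivable Ax (B ++ (a ⊢ b) :: C) ->
    derivable Ax (B ++ (a ⊓ c ⊢ b ⊓ c) :: C)
| d_meetr B C a b c :
    derivable Ax (B ++ (a ⊢ b) :: C) ->
    derivable Ax (B ++ (c ⊓ a ⊢ c ⊓ b) :: C)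
| d_joinl B C a b c :
    derivable Ax (B ++ (a ⊢ b) :: C) ->
    derivable Ax (B ++ (a ⊔ c ⊢ b ⊔ c) :: C)
| d_joinr B C a b c :
    derivable Ax (B ++ (a ⊢ b) :: C) ->
    derivable Ax (B ++ (c ⊔ a ⊢ c ⊔ b) :: C)
| d_neg B C a b :
    derivable Ax (B ++ (a ⊢ b) :: C) ->
    derivable Ax (B ++ (¬ b ⊢ ¬ a) :: C)
| d_opp B C a b :
    derivable Ax (B ++ (a ⊢ b) :: C) ->
    derivable Ax (B ++ (⌟ b ⊢ ⌟ a) :: C)
| d_box B C a b :
    derivable Ax (B ++ (a ⊢ b) :: C) ->
    derivable Ax (B ++ (□ a ⊢ □ b) :: C)
| d_bbox B C a b :
    derivable Ax (B ++ (a ⊢ b) :: C) ->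
    derivable Ax (B ++ (■ a ⊢ ■ b) :: C)
| d_trans B C D E a b c :
    derivable Ax (B ++ (a ⊢ b) :: C) ->
    derivable Ax (D ++ (b ⊢ c) :: E) ->
    derivable Ax (B ++ D ++ (a ⊢ c) :: C ++ E)
| d_order B C D E F G H X a b :
    derivable Ax (B ++ (a ⊓ b ⊢ a ⊓ a) :: C) ->
    derivable Ax (D ++ (a ⊓ a ⊢ a ⊓ b) :: E) ->
    derivable Ax (F ++ (a ⊔ b ⊢ b ⊔ b) :: G) ->
    derivable Ax (H ++ (b ⊔ b ⊢ a ⊔ b) :: X) ->
    derivable Ax (B ++ D ++ F ++ H ++ (a ⊢ b) :: C ++ E ++ G ++ X)
| d_contraction B C D :
    derivable Ax (B ++ D ++ D ++ C) -> derivable Ax (B ++ D ++ C)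
| d_exchange B C D E :
    derivable Ax (B ++ D ++ E ++ C) -> derivable Ax (B ++ E ++ D ++ C)
| d_weakening B C : derivable Ax B -> derivable Ax (B ++ C).

Fixpoint subst (so sp : nat -> form) (a : form) : form :=
  match a with
  | OVar p => so p
  | PVar P => sp P
  | Top => Top
  | Bot => Bot
  | Meet a b => Meet (subst so sp a) (subst so sp b)
  | Join a b => Join (subst so sp a) (subst so sp b)
  | Neg a => Neg (subst so sp a)
  | Opp a => Opp (subst so sp a)
  | Box a => Box (subst so sp a)
  | BBox a => BBox (subst so sp a)
  end.

(* Since object variables denote elements of [D_meet] (that is, elements of
   the form [x ⊓ x]), they may only be replaced by object variables or by
   formulae [c ⊓ c]; dually for property variables. *)
Definition sorted_subst (so sp : nat -> form) : Prop :=
  (forall p, (exists q, so p = OVar q) \/ (exists c, so p = (c ⊓ c)%form)) /\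
  (forall P, (exists Q, sp P = PVar Q) \/ (exists c, sp P = (c ⊔ c)%form)).

Inductive instance (Sigma : sequent -> Prop) : sequent -> Prop :=
| Instance so sp a b :
    sorted_subst so sp -> Sigma (a ⊢ b) ->
    instance Sigma (subst so sp a ⊢ subst so sp b).

(* Provability in MPDBL extended with the sequents of [Sigma] as axioms.  As
   with the axioms of MPDBL itself, these are read schematically: every
   sort-respecting instance is an axiom.  Without this, completeness fails: if
   [Sigma] consists of the single sequent [OVar 0 ⊢ OVar 1], then
   [OVar 1 ⊢ OVar 0] is valid wherever [Sigma] is, but is not derivable from
   [Sigma].  When [Sigma] is already closed under such substitutions, as is
   the set of all instances of schemes in metavariables for formulae, nothing
   is added ([provable_closed] below). *)
Definition provable (Sigma : sequent -> Prop) (G : hypersequent) : Prop :=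
  derivable (instance Sigma) G.

Definition subst_closed (Sigma : sequent -> Prop) : Prop :=
  forall so sp a b, sorted_subst so sp ->
    Sigma (a ⊢ b) -> Sigma (subst so sp a ⊢ subst so sp b).

Record valuation (D : pdbao) : Type := Valuation {
  vo : nat -> D;
  vp : nat -> D;
  vo_meet : forall p, D_meet D (vo p);
  vp_join : forall P, D_join D (vp P) }.

Arguments vo {D} _ _.
Arguments vp {D} _ _.

Fixpoint eval (D : pdbao) (v : valuation D) (a : form) : D :=
  match a with
  | OVar p => vo v p
  | PVar P => vp v P
  | Top => dtop
  | Bot => dbot
  | Meet a b => dmeet (eval D v a) (eval D v b)
  | Join a b => djoin (eval D v a) (eval D v b)
  | Neg a => dneg (eval D v a)
  | Opp a => dopp (eval D v a)
  | Box a => opI (eval D v a)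
  | BBox a => opC (eval D v a)
  end.

Definition satisfies_seq (D : pdbao) (v : valuation D) (s : sequent) : Prop :=
  dle D (eval D v (lhs s)) (eval D v (rhs s)).

Definition satisfies (D : pdbao) (v : valuation D) (G : hypersequent) : Prop :=
  exists s, In s G /\ satisfies_seq D v s.

Definition true_in (D : pdbao) (G : hypersequent) : Prop :=
  forall v : valuation D, satisfies D v G.

Definition valid_in (K : pdbao -> Prop) (G : hypersequent) : Prop :=
  forall D : pdbao, K D -> true_in D G.

Definition V (Sigma : sequent -> Prop) (D : pdbao) : Prop :=
  forall s, Sigma s -> true_in D [s].

Lemma derivable_mono (Ax Ax' : sequent -> Prop) (G : hypersequent) :
  (forall s, Ax s -> Ax' s) -> derivable Ax G -> derivable Ax' G.
Proof. intros H d; induction d; eauto using derivable. Qed.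

Lemma subst_var (a : form) : subst OVar PVar a = a.
Proof. induction a; simpl; congruence. Qed.

Lemma provable_closed (Sigma : sequent -> Prop) (G : hypersequent) :
  subst_closed Sigma -> provable Sigma G <-> derivable Sigma G.
Proof.
intro H; split; apply derivable_mono.
- intros s [so sp a b Hs Hab]; apply H; assumption.
- intros [a b] Hab.
  rewrite <- (subst_var a), <- (subst_var b).
  constructor; [split; eauto | assumption].
Qed.

(* Main.v *)
(** Suppose [G] is not derivable.  Extend its components to a maximal set [Delta]
    of sequents no finite list of which is derivable, and let [T] be the
    complement of [Delta].  By maximality [T s] holds iff [s | L] is derivable for
    some list [L] of sequents outside [T]; carrying [L] along as a side
    hypersequent shows that [T] is closed under the rules, and (Sp) puts
    [a ⊢ a ⊓ a] or [a ⊔ a ⊢ a] in [T].  Hence the formulae modulo [T] form a pure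
    dBa with operators.  A valuation in it is a sort-respecting substitution, so
    [Sigma] is valid there, while the canonical valuation refutes [G]. *)
Require Import Defs.
From Stdlib Require Import Classical ClassicalEpsilon FunctionalExtensionality
  PropExtensionality Cantor PeanoNat Lia.

(** * Structural rules: only the set of components matters *)

Lemma derivable_absorb (Ax : sequent -> Prop) (s : sequent) (G : hypersequent) :
  In s G -> derivable Ax (s :: G) -> derivable Ax G.
Proof.
intros Hs d; destruct (in_split _ _ Hs) as (G1 & G2 & ->).
apply (d_contraction Ax G1 G2 [s]).
exact (d_exchange Ax [] (s :: G2) [s] G1 d).
Qed.

(** Weakening appends [G']; each component of [G] then has a copy in [G'] and is absorbed by
    exchange and contraction. *)
Lemma derivable_incl (Ax : sequent -> Prop) (G G' : hypersequent) :
  incl G G' -> derivable Ax G -> derivable Ax G'.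
Proof.
intros Hincl d; apply (d_weakening _ _ G') in d; revert Hincl d.
induction G as [|s G IH]; simpl; intros Hincl d; [assumption|].
apply incl_cons_inv in Hincl as [Hs Hincl].
apply IH; [assumption|].
apply derivable_absorb with (2 := d), in_or_app; auto.
Qed.

(** * Numbering of formulae and sequents *)

Fixpoint form_code (a : form) : nat :=
  match a with
  | OVar n => to_nat (0, n)
  | PVar n => to_nat (1, n)
  | Top => to_nat (2, 0)
  | Bot => to_nat (3, 0)
  | Meet a b => to_nat (4, to_nat (form_code a, form_code b))
  | Join a b => to_nat (5, to_nat (form_code a, form_code b))
  | Neg a => to_nat (6, form_code a)
  | Opp a => to_nat (7, form_code a)
  | Box a => to_nat (8, form_code a)
  | BBox a => to_nat (9, form_code a)
  end.

Lemma form_code_inj (a b : form) : form_code a = form_code b -> a = b.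
Proof.
revert b; induction a; intros []; cbn [form_code]; intro H;
  apply to_nat_inj in H; try discriminate H;
  apply pair_equal_spec in H as [_ H];
  try (apply to_nat_inj, pair_equal_spec in H as [H H']);
  f_equal; auto.
Qed.

Definition sequent_code (s : sequent) : nat :=
  to_nat (form_code (lhs s), form_code (rhs s)).

Lemma sequent_code_inj (s t : sequent) :
  sequent_code s = sequent_code t -> s = t.
Proof.
destruct s, t; unfold sequent_code; intro H; apply to_nat_inj, pair_equal_spec in H as [H H'].
f_equal; apply form_code_inj; assumption.
Qed.

(** * Maximal consistent sets *)

(** A hypersequent is read as a disjunction, so [Delta] collects sequents that are to be refuted
    together. *)
Definition consistent (Ax Delta : sequent -> Prop) : Prop :=
  forall L, (forall s, In s L -> Delta s) -> ~ derivable Ax L.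

Lemma consistent_sub (Ax Delta Delta' : sequent -> Prop) :
  (forall s, Delta s -> Delta' s) -> consistent Ax Delta' -> consistent Ax Delta.
Proof. intros H HD' L HL; apply HD'; auto. Qed.

Fixpoint stage (Ax : sequent -> Prop) (G : hypersequent) (n : nat)
    (s : sequent) : Prop :=
  match n with
  | 0 => In s G
  | S n => stage Ax G n s \/
      (sequent_code s = n /\ consistent Ax (fun t => stage Ax G n t \/ t = s))
  end.

Lemma stage_le (Ax : sequent -> Prop) (G : hypersequent) (m n : nat)
    (s : sequent) : m <= n -> stage Ax G m s -> stage Ax G n s.
Proof. intros Hmn Hs; induction Hmn; simpl; auto. Qed.

Lemma stage_consistent (Ax : sequent -> Prop) (G : hypersequent) (n : nat) :
  ~ derivable Ax G -> consistent Ax (stage Ax G n).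
Proof.
intro HG; induction n as [|n IH].
- intros L HL d; apply HG, (derivable_incl _ L); assumption.
- destruct (classic (exists s, sequent_code s = n /\
    consistent Ax (fun t => stage Ax G n t \/ t = s))) as [(s & Hs & Hcon)|Hno].
  (* Codes are injective, so [s] is the only sequent that can enter at this stage. *)
  + apply consistent_sub with (2 := Hcon); intros t [Ht|[Ht _]]; [now left|].
    right; apply sequent_code_inj; congruence.
  + apply consistent_sub with (2 := IH); intros t [Ht|Ht]; [assumption|].
    destruct Hno; eauto.
Qed.

Lemma stage_union_consistent (Ax : sequent -> Prop) (G : hypersequent) :
  ~ derivable Ax G -> consistent Ax (fun s => exists n, stage Ax G n s).
Proof.
intros HG L HL.
(* Stages increase, so a finite list already lies in one of them. *)
assert (exists n, forall s, In s L -> stage Ax G n s) as [n Hn].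
{ induction L as [|s L IH]; [exists 0; intros _ []|].
  destruct IH as [n Hn]; [intros t Ht; apply HL; now right|].
  destruct (HL s (or_introl eq_refl)) as [m Hm].
  exists (Nat.max m n); intros t [<-|Ht].
  - apply stage_le with (2 := Hm); lia.
  - apply stage_le with (2 := Hn t Ht); lia. }
exact (stage_consistent Ax G n HG L Hn).
Qed.

(* The complements of the maximal consistent sets. *)
Definition prime (Ax T : sequent -> Prop) : Prop :=
  forall s, T s <->
    exists L, (forall t, In t L -> ~ T t) /\ derivable Ax (s :: L).

Lemma prime_extension (Ax : sequent -> Prop) (G : hypersequent) :
  ~ derivable Ax G ->
  exists T, prime Ax T /\ forall s, In s G -> ~ T s.
Proof.
intro HG.
pose proof (stage_union_consistent Ax G HG) as Hcon.
exists (fun s => ~ exists n, stage Ax G n s); split.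
2: { intros s Hs Hn; apply Hn; exists 0; exact Hs. }
intro s; split.
- intro Hs.
  (* [s] was rejected at the stage of its own code, so some derivable [L] consists of sequents of
     that stage and possibly [s]. Deleting [s] from [L] leaves the side list. *)
  assert (~ consistent Ax (fun t => stage Ax G (sequent_code s) t \/ t = s))
    as Hinc.
  { intro H; apply Hs; exists (S (sequent_code s)); right; auto. }
  apply not_all_ex_not in Hinc as [L HL].
  apply imply_to_and in HL as [HL d]; apply NNPP in d.
  assert (forall t u : sequent, {t = u} + {t <> u}) as dec
    by (intros; apply excluded_middle_informative).
  exists (remove dec s L); split.
  + intros t Ht Hn; apply Hn; apply in_remove in Ht as [Ht Hts].
    destruct (HL t Ht) as [Hst|]; [eauto|contradiction].
  + apply (derivable_incl _ L); [|assumption]; intros t Ht.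
    destruct (dec t s) as [->|Hts]; [now left|right].
    now apply in_in_remove.
- intros (L & HL & d) Hs; apply (Hcon (s :: L)); [|assumption].
  intros t [<-|Ht]; [assumption|]; apply NNPP; auto.
Qed.

(** * The quotient of formulae *)

Definition equiv (T : sequent -> Prop) (a b : form) : Prop :=
  T (a ⊢ b) /\ T (b ⊢ a).

(** Classes are predicates, so that the algebra identities can be stated with Rocq equality;
    operations act on chosen representatives. *)
Definition quot (T : sequent -> Prop) : Type :=
  {S : form -> Prop | exists a, S = equiv T a}.

Definition cls (T : sequent -> Prop) (a : form) : quot T :=
  exist _ (equiv T a) (ex_intro _ a eq_refl).

Definition rep (T : sequent -> Prop) (x : quot T) : form :=
  proj1_sig (constructive_indefinite_description _ (proj2_sig x)).

Lemma cls_rep (T : sequent -> Prop) (x : quot T) : cls T (rep T x) = x.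
Proof.
unfold rep; destruct (constructive_indefinite_description _ _) as [a Ha]; simpl.
destruct x as [S HS]; simpl in Ha; subst S.
unfold cls; f_equal; apply proof_irrelevance.
Qed.

Definition quot_sig (T : sequent -> Prop) : dba_sig := {|
  carrier := quot T;
  djoin x y := cls T (rep T x ⊔ rep T y)%form;
  dmeet x y := cls T (rep T x ⊓ rep T y)%form;
  dneg x := cls T (¬ rep T x)%form;
  dopp x := cls T (⌟ rep T x)%form;
  dtop := cls T ⊤%form;
  dbot := cls T ⊥%form |}.

(** * Closure of a prime set under the rules *)

Section PrimeQuotient.

Context (Ax T : sequent -> Prop) (HT : prime Ax T).

Lemma prime_derivable (s : sequent) : derivable Ax [s] -> T s.
Proof. intro d; apply HT; exists []; split; [intros _ []|assumption]. Qed.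

(** The side list witnessing [T s] also witnesses [T s']. *)
Lemma prime_rule (s s' : sequent) :
  (forall L, derivable Ax (s :: L) -> derivable Ax (s' :: L)) -> T s -> T s'.
Proof.
intros Hrule Hs; apply HT in Hs as (L & HL & d); apply HT; eauto.
Qed.

Lemma prime_ax_le (a b : form) : ax_le a b -> T (a ⊢ b).
Proof. intro; apply prime_derivable, d_le; assumption. Qed.

Lemma prime_ax_eq (a b : form) : ax_eq a b -> equiv T a b.
Proof.
intro; split; apply prime_derivable; [apply d_eq|apply d_eq_sym]; assumption.
Qed.

Lemma prime_refl (a : form) : T (a ⊢ a).
Proof. apply prime_ax_le; constructor. Qed.

Lemma prime_trans (a b c : form) : T (a ⊢ b) -> T (b ⊢ c) -> T (a ⊢ c).
Proof.
intros Hab Hbc.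
apply HT in Hab as (L & HL & d); apply HT in Hbc as (M & HM & e).
apply HT; exists (L ++ M); split.
- intros t Ht; apply in_app_or in Ht as []; auto.
- exact (d_trans Ax [] L [] M a b c d e).
Qed.

Lemma prime_order (a b : form) :
  equiv T (a ⊓ b)%form (a ⊓ a)%form -> equiv T (a ⊔ b)%form (b ⊔ b)%form ->
  T (a ⊢ b).
Proof.
intros [H1 H2] [H3 H4].
apply HT in H1 as (L1 & HL1 & d1); apply HT in H2 as (L2 & HL2 & d2).
apply HT in H3 as (L3 & HL3 & d3); apply HT in H4 as (L4 & HL4 & d4).
apply HT; exists (L1 ++ L2 ++ L3 ++ L4); split.
- intros t Ht; rewrite !in_app_iff in Ht; intuition eauto.
- exact (d_order Ax [] L1 [] L2 [] L3 [] L4 a b d1 d2 d3 d4).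
Qed.

Lemma prime_sp (a : form) : T (a ⊢ a ⊓ a) \/ T (a ⊔ a ⊢ a).
Proof.
destruct (classic (T (a ⊔ a ⊢ a))) as [|H]; [now right|left].
(* The second component of (Sp) lies outside [T], so it can serve as the side list of the first. *)
apply HT; exists [a ⊔ a ⊢ a]; split; [|apply d_sp].
intros t [<-|[]]; assumption.
Qed.

Lemma prime_meet (a a' b b' : form) :
  T (a ⊢ a') -> T (b ⊢ b') -> T (a ⊓ b ⊢ a' ⊓ b').
Proof.
intros Ha Hb; apply prime_trans with (a' ⊓ b)%form.
- apply prime_rule with (2 := Ha); intro L; exact (d_meetl Ax [] L a a' b).
- apply prime_rule with (2 := Hb); intro L; exact (d_meetr Ax [] L b b' a').
Qed.

Lemma prime_join (a a' b b' : form) :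
  T (a ⊢ a') -> T (b ⊢ b') -> T (a ⊔ b ⊢ a' ⊔ b').
Proof.
intros Ha Hb; apply prime_trans with (a' ⊔ b)%form.
- apply prime_rule with (2 := Ha); intro L; exact (d_joinl Ax [] L a a' b).
- apply prime_rule with (2 := Hb); intro L; exact (d_joinr Ax [] L b b' a').
Qed.

Lemma prime_neg (a b : form) : T (a ⊢ b) -> T (¬ b ⊢ ¬ a).
Proof. apply prime_rule; intro L; exact (d_neg Ax [] L a b). Qed.

Lemma prime_opp (a b : form) : T (a ⊢ b) -> T (⌟ b ⊢ ⌟ a).
Proof. apply prime_rule; intro L; exact (d_opp Ax [] L a b). Qed.

Lemma prime_box (a b : form) : T (a ⊢ b) -> T (□ a ⊢ □ b).
Proof. apply prime_rule; intro L; exact (d_box Ax [] L a b). Qed.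

Lemma prime_bbox (a b : form) : T (a ⊢ b) -> T (■ a ⊢ ■ b).
Proof. apply prime_rule; intro L; exact (d_bbox Ax [] L a b). Qed.

Lemma prime_meetl (a b c : form) : T (a ⊢ c) -> T (a ⊓ b ⊢ c).
Proof. apply prime_trans, prime_ax_le; constructor. Qed.

Lemma prime_meetr (a b c : form) : T (b ⊢ c) -> T (a ⊓ b ⊢ c).
Proof. apply prime_trans, prime_ax_le; constructor. Qed.

Lemma prime_joinl (a b c : form) : T (c ⊢ a) -> T (c ⊢ a ⊔ b).
Proof.
intro H; apply prime_trans with (1 := H), prime_ax_le; constructor.
Qed.

Lemma prime_joinr (a b c : form) : T (c ⊢ b) -> T (c ⊢ a ⊔ b).
Proof.
intro H; apply prime_trans with (1 := H), prime_ax_le; constructor.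
Qed.

(* [⊓] is a greatest lower bound only for meets below it: in general
   [c ⊢ c ⊓ c] fails. *)
Lemma prime_meet_glb (a b c d : form) :
  T (c ⊓ d ⊢ a) -> T (c ⊓ d ⊢ b) -> T (c ⊓ d ⊢ a ⊓ b).
Proof.
intros Ha Hb; apply prime_trans with ((c ⊓ d) ⊓ (c ⊓ d))%form.
- apply prime_ax_le; constructor.
- apply prime_meet; assumption.
Qed.

Lemma prime_join_lub (a b c d : form) :
  T (a ⊢ c ⊔ d) -> T (b ⊢ c ⊔ d) -> T (a ⊔ b ⊢ c ⊔ d).
Proof.
intros Ha Hb; apply prime_trans with ((c ⊔ d) ⊔ (c ⊔ d))%form.
- apply prime_join; assumption.
- apply prime_ax_le; constructor.
Qed.

(** * Operations on classes and the algebra laws *)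

Lemma equiv_sym (a b : form) : equiv T a b -> equiv T b a.
Proof. intros []; split; assumption. Qed.

Lemma equiv_trans (a b c : form) : equiv T a b -> equiv T b c -> equiv T a c.
Proof. intros [] []; split; eauto using prime_trans. Qed.

Lemma cls_eq (a b : form) : cls T a = cls T b <-> equiv T a b.
Proof.
split.
- intro H; apply (f_equal (@proj1_sig _ _)) in H; simpl in H.
  rewrite H; split; apply prime_refl.
- intro H; assert (equiv T a = equiv T b) as E.
  { extensionality c; apply propositional_extensionality.
    split; apply equiv_trans; [apply equiv_sym|]; assumption. }
  (* The type of the membership proof mentions [equiv T a]; abstracting the proof lets [E] rewrite
     both at once. *)
  unfold cls; generalize (ex_intro (fun c => equiv T a = equiv T c) a eq_refl).
  rewrite E; intro e; f_equal; apply proof_irrelevance.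
Qed.

Lemma rep_cls (a : form) : equiv T (rep T (cls T a)) a.
Proof. apply cls_eq, cls_rep. Qed.

Lemma cls_unary (f : form -> form) (a : form) :
  (forall b c, equiv T b c -> equiv T (f b) (f c)) ->
  cls T (f (rep T (cls T a))) = cls T (f a).
Proof. intro Hf; apply cls_eq, Hf, rep_cls. Qed.

Lemma cls_meet (a b : form) :
  dmeet (d := quot_sig T) (cls T a) (cls T b) = cls T (a ⊓ b)%form.
Proof.
apply cls_eq; destruct (rep_cls a), (rep_cls b).
split; apply prime_meet; assumption.
Qed.

Lemma cls_join (a b : form) :
  djoin (d := quot_sig T) (cls T a) (cls T b) = cls T (a ⊔ b)%form.
Proof.
apply cls_eq; destruct (rep_cls a), (rep_cls b).
split; apply prime_join; assumption.
Qed.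

Lemma cls_neg (a : form) : dneg (d := quot_sig T) (cls T a) = cls T (¬ a)%form.
Proof. apply (cls_unary Neg); intros b c []; split; apply prime_neg; auto. Qed.

Lemma cls_opp (a : form) : dopp (d := quot_sig T) (cls T a) = cls T (⌟ a)%form.
Proof. apply (cls_unary Opp); intros b c []; split; apply prime_opp; auto. Qed.

Definition quot_I (x : quot_sig T) : quot_sig T := cls T (□ rep T x)%form.
Definition quot_C (x : quot_sig T) : quot_sig T := cls T (■ rep T x)%form.

Lemma cls_box (a : form) : quot_I (cls T a) = cls T (□ a)%form.
Proof. apply (cls_unary Box); intros b c []; split; apply prime_box; auto. Qed.

Lemma cls_bbox (a : form) : quot_C (cls T a) = cls T (■ a)%form.
Proof. apply (cls_unary BBox); intros b c []; split; apply prime_bbox; auto. Qed.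

Lemma cls_top : dtop (d := quot_sig T) = cls T ⊤%form.
Proof. reflexivity. Qed.

Lemma cls_bot : dbot (d := quot_sig T) = cls T ⊥%form.
Proof. reflexivity. Qed.

Lemma quot_ind (P : quot_sig T -> Prop) :
  (forall a, P (cls T a)) -> forall x, P x.
Proof. intros H x; rewrite <- (cls_rep T x); apply H. Qed.

Ltac to_equiv :=
  repeat (refine (quot_ind _ _); intro);
  rewrite ?cls_top, ?cls_bot;
  repeat progress
    rewrite ?cls_meet, ?cls_join, ?cls_neg, ?cls_opp, ?cls_box, ?cls_bbox;
  apply cls_eq.

(** Handles laws that are not axioms: a sequent is an axiom, follows from the bound properties of
    [⊓] and [⊔], or reduces to a reversed one under [¬] or [⌟]. *)
Ltac bounds :=
  solve [ apply prime_ax_le; constructor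
        | repeat first [apply prime_meet_glb | apply prime_join_lub];
          auto 10 using prime_refl, prime_meetl, prime_meetr,
            prime_joinl, prime_joinr
        | apply prime_neg; bounds
        | apply prime_opp; bounds ].

Lemma quot_dba : is_dba (quot_sig T).
Proof.
constructor; to_equiv;
  solve [ apply prime_ax_eq; constructor
        (* [ax_meet_join_id] is oriented oppositely to [dba_meet_join_id]. *)
        | apply equiv_sym, prime_ax_eq; constructor
        | split; bounds ].
Qed.

Lemma quot_pure : is_pure (quot_sig T).
Proof.
refine (quot_ind _ _); intro a; unfold D_meet, D_join.
rewrite cls_meet, cls_join, !cls_eq.
destruct (prime_sp a); [left|right]; split;
  auto using prime_meetl, prime_joinl, prime_refl.
Qed.

(** From left to right this is the four-premise rule [d_order], whose premises spell out [dle]; the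
    converse uses the bound properties. *)
Lemma cls_le (a b : form) :
  dle (quot_sig T) (cls T a) (cls T b) <-> T (a ⊢ b).
Proof.
unfold dle; rewrite !cls_meet, !cls_join, !cls_eq; split.
- intros []; apply prime_order; assumption.
- split; split; first [apply prime_meet_glb | apply prime_join_lub];
    auto using prime_meetl, prime_meetr, prime_joinl, prime_joinr, prime_refl.
Qed.

Definition quot_pdbao : pdbao.
Proof.
refine {| pdbao_sig := quot_sig T; opI := quot_I; opC := quot_C;
          pdbao_dba := quot_dba; pdbao_pure := quot_pure |}.
1, 2: do 2 (refine (quot_ind _ _); intro);
  rewrite ?cls_box, ?cls_bbox, !cls_le; auto using prime_box, prime_bbox.
all: to_equiv; solve [ apply prime_ax_eq; constructor
                     | apply equiv_sym, prime_ax_eq; constructor ].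
Defined.

Lemma quot_eval (v : valuation quot_pdbao) (so sp : nat -> form) :
  (forall p, vo v p = cls T (so p)) -> (forall P, vp v P = cls T (sp P)) ->
  forall a, eval quot_pdbao v a = cls T (subst so sp a).
Proof.
intros Ho Hp a; induction a; simpl eval; simpl subst; auto;
  rewrite ?IHa, ?IHa1, ?IHa2;
  first [ reflexivity | apply cls_meet | apply cls_join | apply cls_neg
        | apply cls_opp | apply cls_box | apply cls_bbox ].
Qed.

Lemma quot_valuation_subst (v : valuation quot_pdbao) :
  exists so sp, sorted_subst so sp /\
    forall a, eval quot_pdbao v a = cls T (subst so sp a).
Proof.
(* A representative alone need not have the shape [sorted_subst] asks for. Its square does, and it
   stays in the same class because [vo v p] and [vp v P] are idempotent for [⊓] and [⊔]
   respectively. *)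
exists (fun p => rep T (vo v p) ⊓ rep T (vo v p))%form,
  (fun P => rep T (vp v P) ⊔ rep T (vp v P))%form; split.
- split; eauto.
- apply quot_eval; intro n; symmetry; [apply (vo_meet _ v)|apply (vp_join _ v)].
Qed.

Definition quot_valuation : valuation quot_pdbao.
Proof.
refine (Valuation quot_pdbao (fun p => cls T (OVar p)) (fun P => cls T (PVar P))
  _ _); intro n; unfold D_meet, D_join; simpl pdbao_sig.
- rewrite cls_meet; apply cls_eq, prime_ax_eq; constructor.
- rewrite cls_join; apply cls_eq, prime_ax_eq; constructor.
Defined.

(** Truth lemma: the canonical valuation corresponds to the identity substitution, so it sends each
    formula to its own class. *)
Lemma quot_valuation_satisfies (s : sequent) :
  satisfies_seq quot_pdbao quot_valuation s <-> T s.
Proof.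
destruct s as [a b]; unfold satisfies_seq; simpl lhs; simpl rhs.
rewrite !(quot_eval quot_valuation OVar PVar) by reflexivity.
rewrite !subst_var; apply cls_le.
Qed.

End PrimeQuotient.

(** * Completeness *)

Lemma quot_in_V (Sigma T : sequent -> Prop) (HT : prime (instance Sigma) T) :
  V Sigma (quot_pdbao (instance Sigma) T HT).
Proof.
intros [a b] Hs v; exists (a ⊢ b); split; [now left|].
destruct (quot_valuation_subst _ _ HT v) as (so & sp & Hsort & Heval).
unfold satisfies_seq; rewrite !Heval; simpl lhs; simpl rhs.
(* The substituted sequent is itself an axiom of [instance Sigma], hence in [T]. *)
apply (cls_le _ _ HT), (prime_derivable _ _ HT), d_ax.
constructor; assumption.
Qed.

Theorem theorem53 (Sigma : sequent -> Prop) (G : hypersequent) :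
  valid_in (V Sigma) G -> provable Sigma G.
Proof.
intro Hvalid; apply NNPP; intro HG.
destruct (prime_extension _ _ HG) as (T & HT & HGT).
destruct (Hvalid _ (quot_in_V Sigma T HT) (quot_valuation _ _ HT))
  as (s & Hs & Hsat).
apply (HGT s Hs), (quot_valuation_satisfies _ _ HT), Hsat.
Qed.
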